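(* Let $n\ge 3$ and $m\ge 2$ be integers and consider the cycle-based self-similar graphs $G^{(i)}=G^{(i,m,n)}$ defined in the context. (a) If $n\ge 4$, then the average clustering coefficient of $G^{(i,m,n)}$ equals $0$ for every $i\ge 0$. (b) If $n=3$, then for every $i\ge 1$ the average clustering coefficient of $G^{(i,m,3)}$ is $$\bar{\mathcal A}\big(G^{(i,m,3)}\big)=\frac{\dfrac{3}{\binom{2(i+1)}{2}}+\displaystyle\sum_{j=1}^{i-1}\frac{|V^{(j+1)}|-|V^{(j)}|}{\binom{2(i-j+1)}{2}}+2|V^{(i)}|}{|V^{(i+1)}|},$$ where for $k\ge 0$, $|V^{(k)}|$ denotes the number of vertices of $G^{(k-1,m,3)}$ and $G^{(-1,m,3)}$ is a single vertex (an empty sum is $0$).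
   Context: The edge-path transformation replaces every edge of a graph by a path of length $m$ (inserting $m-1$ new internal vertices on each edge). The cycle-based model: $G^{(0)}=C_n$, and for $i\ge 0$, $G^{(i+1)}$ is obtained from $G^{(i)}$ by first applying the edge-path transformation, and then, for every vertex $v$ of $G^{(i)}$ (i.e. every vertex present before the subdivision), attaching a new copy of $C_n$ by identifying $v$ with one vertex of that copy. The clustering coefficient of a vertex $v$ of degree $k_v$ is $C_v=\frac{2\mathcal E_v}{k_v(k_v-1)}$, where $\mathcal E_v$ is the number of edges between neighbours of $v$; the average clustering coefficient $\bar{\mathcal A}(G)$ is the mean of $C_v$ over all vertices of $G$. *)

(* Defs.v *)
From HB Require Import structures.
From mathcomp Require Import all_boot all_order all_algebra.

Set Implicit Arguments.
Unset Strict Implicit.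
Unset Printing Implicit Defensive.

Import GRing.Theory.
Local Open Scope ring_scope.

Record sgraph := SGraph {
  vertex :> finType;
  adj : rel vertex;
  adj_sym : symmetric adj;
  adj_irrefl : irreflexive adj }.

Definition nbhd (G : sgraph) (v : G) : {set G} := [set w | adj v w].

Definition deg (G : sgraph) (v : G) : nat := #|nbhd v|.

Definition edges (G : sgraph) : {set {set G}} :=
  [set [set p.1; p.2] | p in [set p : G * G | adj p.1 p.2]].

Definition edges_among_nbrs (G : sgraph) (v : G) : nat :=
  #|[set e in edges G | e \subset nbhd v]|.

(** As x / 0 = 0, this is 0 on vertices of degree at most 1. *)
Definition clustering (G : sgraph) (v : G) : rat :=
  2 * (edges_among_nbrs v)%:R / ((deg v)%:R * ((deg v)%:R - 1)).

Definition avg_clustering (G : sgraph) : rat :=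
  (\sum_(v : G) clustering v) / #|G|%:R.

(** 'Z_n is the integers mod n only for n >= 2, and this is a cycle only for
    n >= 3. *)
Definition cycle_adj n : rel 'Z_n := [rel x y | (y == x + 1) || (x == y + 1)].

Lemma cycle_adj_sym n : symmetric (@cycle_adj n).
Proof. by move=> x y; rewrite /cycle_adj /= orbC. Qed.

Lemma cycle_adj_irrefl n : irreflexive (@cycle_adj n).
Proof.
by move=> x; rewrite /cycle_adj /= orbb eq_sym -subr_eq0 [x + 1]addrC addrK oner_eq0.
Qed.

Definition cycle_graph n : sgraph :=
  SGraph (@cycle_adj_sym n) (@cycle_adj_irrefl n).

Section EdgePath.
Variables (m : nat) (G : sgraph).

(** Each edge of G, represented once: its endpoints are listed in the order of
    the enumeration of the vertices. *)
Definition oedge :=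
  {e : G * G | adj e.1 e.2 && (enum_rank e.1 < enum_rank e.2)%N}.

Definition ep_vertex : finType := (G + oedge * 'I_m.-1)%type.

(** The path of e = (x, y) has vertices ep_path e 0 = x, then the m - 1 new
    vertices ep_path e 1, ..., ep_path e (m - 1), and ep_path e m = y. *)
Definition ep_path (e : oedge) (k : nat) : ep_vertex :=
  if k is k'.+1 then
    if insub k' is Some j then inr (e, j) else inl (val e).2
  else inl (val e).1.

Definition ep_adj : rel ep_vertex := [rel u w |
  [exists e : oedge, exists k : 'I_m,
     ((u == ep_path e k) && (w == ep_path e k.+1)) ||
     ((w == ep_path e k) && (u == ep_path e k.+1))]].

Lemma ep_adj_sym : symmetric ep_adj.
Proof.
by move=> u w; rewrite /ep_adj /=; apply: eq_existsb => e; apply: eq_existsb => k; rewrite orbC.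
Qed.

Lemma ep_adj_irrefl : irreflexive ep_adj.
Proof.
move=> u; rewrite /ep_adj /=; apply/negbTE/negP => /existsP[e].
case/existsP=> k; rewrite orbb => /andP[/eqP ->].
case: k => -[|k] km /=; case: insubP => [j _ jE|kN] //=.
- by case/eqP=> exy; case/andP: (valP e); rewrite exy adj_irrefl.
- case: insubP => [j' _ j'E|_] // /eqP[jj].
  have : val j = val j' by rewrite jj.
  by rewrite jE j'E => /eqP; rewrite eqn_leq ltnn ?andbF.
- by move: kN; rewrite ltn_predRL km.
Qed.

Definition edge_path : sgraph := SGraph ep_adj_sym ep_adj_irrefl.

End EdgePath.

(** For each t : T, a new copy of K is attached to H by identifying the vertex r
    of the copy with the vertex f t of H. *)

Section Attach.
Variables (H : sgraph) (T : finType) (f : T -> H) (K : sgraph) (r : K).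

Definition attach_vertex : finType := (H + T * {x : K | x != r})%type.

Definition attach_copy (t : T) (x : K) : attach_vertex :=
  if insub x is Some x' then inr (t, x') else inl (f t).

Definition attach_adj : rel attach_vertex := [rel u w |
  (if (u, w) is (inl x, inl y) then adj x y else false) ||
  [exists t : T, exists x : K, exists y : K,
     [&& adj x y, u == attach_copy t x & w == attach_copy t y]]].

Lemma attach_adj_sym : symmetric attach_adj.
Proof.
move=> u w; rewrite /attach_adj /=; congr (_ || _); first by case: u w => [x|x] [y|y] //; rewrite adj_sym.
apply: eq_existsb => t; apply/existsP/existsP => -[x /existsP[y /and3P[xy ux wy]]];
  by exists y; apply/existsP; exists x; rewrite adj_sym xy ux wy.
Qed.

Lemma attach_adj_irrefl : irreflexive attach_adj.
Proof.
move=> u; rewrite /attach_adj /=; apply/negbTE/negP => /orP[|]; first by case: u => // x; rewrite adj_irrefl.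
case/existsP=> t /existsP[x /existsP[y /and3P[xy /eqP-> /eqP]]].
rewrite /attach_copy; case: insubP => [x' _ xE|]; case: insubP => [y' _ yE|] //.
  by case=> xy'; move: xy; rewrite -xE -yE xy' adj_irrefl.
by rewrite !negbK => /eqP yr /eqP xr; move: xy; rewrite xr yr adj_irrefl.
Qed.

Definition attach : sgraph := SGraph attach_adj_sym attach_adj_irrefl.

End Attach.

(** G^(i, m, n). The old vertices of edge_path m G are those of the form inl v. *)
Fixpoint ssgraph (m n i : nat) : sgraph :=
  if i is i'.+1 then
    let G := ssgraph m n i' in
    @attach (edge_path m G) G (fun v => inl v) (cycle_graph n) 0
  else cycle_graph n.

(** |V^(k)|, the number of vertices of G^(k - 1, m, n); G^(-1) is a single
    vertex. *)
Definition Vcard (m n k : nat) : nat :=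
  if k is k'.+1 then #|ssgraph m n k'| else 1%N.

(* Main.v *)
(** For m >= 2 the edge-path transformation yields a triangle-free graph, so every
    triangle of G^(i+1) lies inside one of the attached copies of C_n: there is
    none if n >= 4, and if n = 3 every vertex of G^(i) and every new vertex of a
    copy lies in exactly one, while the internal path vertices lie in none.  As a
    vertex enters with degree 2 and gains 2 at each later step, the numbers of
    vertices born at each step determine the distribution of degrees. *)

Require Import Defs.
From mathcomp Require Import all_boot all_order all_algebra.
From mathcomp Require Import zify ring.

Set Implicit Arguments.
Unset Strict Implicit.
Unset Printing Implicit Defensive.

Import GRing.Theory.
Local Open Scope ring_scope.

(** * Edges among neighbours and the clustering coefficient *)

Definition triangle_free (G : sgraph) :=
  forall x y z : G, adj x y -> adj x z -> ~~ adj y z.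

Section Basics.
Variable G : sgraph.
Implicit Types x y v : G.

Lemma in_nbhd v x : (x \in nbhd v) = adj v x.
Proof. by rewrite inE. Qed.

Lemma edgesP (e : {set G}) :
  reflect (exists x y, adj x y /\ e = [set x; y]) (e \in edges G).
Proof.
apply: (iffP imsetP) => [[[x y]]|[x [y [xy ->]]]].
  by rewrite inE /= => xy ->; exists x, y.
by exists (x, y); rewrite ?inE.
Qed.

Lemma card_edge (e : {set G}) : e \in edges G -> #|e| = 2%N.
Proof.
case/edgesP=> x [y [xy ->]]; rewrite cards2.
by case: eqP xy => // ->; rewrite adj_irrefl.
Qed.

Lemma edges_among_nbrs_eq0 v :
  (forall x y, adj v x -> adj v y -> ~~ adj x y) -> edges_among_nbrs v = 0%N.
Proof.
move=> tf; apply/eqP; rewrite cards_eq0; apply/eqP/setP => e; rewrite !inE.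
apply/negP => /andP[/edgesP[x [y [xy ->]]]]; rewrite subUset !sub1set !in_nbhd.
by case/andP=> vx vy; move: (tf _ _ vx vy); rewrite xy.
Qed.

(** The binomial form is the one in the closed formula. It also covers degrees 0 and 1, where both
    denominators vanish and both quotients are 0 by convention. *)
Lemma clusteringE v :
  clustering v = (edges_among_nbrs v)%:R / 'C(deg v, 2)%:R.
Proof.
rewrite /clustering.
have -> : (deg v)%:R * ((deg v)%:R - 1) = 2 * 'C(deg v, 2)%:R :> rat.
  case: (deg v) => [|d]; first by rewrite mul0r mulr0.
  rewrite -natr1 addrK natr1 -!natrM; congr (_%:R).
  by rewrite -(mul_bin_diag _ 1) bin1.
by rewrite -mulf_div divff // mul1r.
Qed.

End Basics.

(** * Neighbourhoods and triangles in cycles *)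

(** Here [y] and [z] differ by 0, 2 or -2, so a difference of 1 or -1 would make 1 or 3 vanish. *)
Lemma no_unit_triangle (R : comNzRingType) (x y z : R) : 3 != 0 :> R ->
    (y == x + 1) || (y == x - 1) -> (z == x + 1) || (z == x - 1) ->
  ~~ ((z == y + 1) || (z == y - 1)).
Proof.
move=> h3; have h1 := oner_neq0 R.
have neq (a b c : R) : c != 0 -> a - b = c -> (a == b) = false.
  by move=> c0 abc; rewrite -subr_eq0 abc; apply: negbTE.
have [hN1 hN3] : - 1 != 0 :> R /\ - 3 != 0 :> R by rewrite !oppr_eq0.
case/orP=> /eqP-> /orP[]/eqP->.
- by rewrite (neq _ _ _ hN1) ?(neq _ _ _ h1) //; ring.
- by rewrite (neq _ _ _ hN3) ?(neq _ _ _ hN1) //; ring.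
- by rewrite (neq _ _ _ h1) ?(neq _ _ _ h3) //; ring.
- by rewrite (neq _ _ _ hN1) ?(neq _ _ _ h1) //; ring.
Qed.

Section Cycle.
Variable n : nat.
Hypothesis n_ge3 : (3 <= n)%N.
Local Notation K := (cycle_graph n).
Implicit Types x y z : 'Z_n.

Lemma Zn_nat_eq0 k : (0 < k < n)%N -> (k%:R == 0 :> 'Z_n) = false.
Proof.
case/andP=> k0 kn; apply/negP => /eqP /(congr1 val) /=.
by rewrite val_Zp_nat ?modn_small //=; lia.
Qed.

Lemma nbhd_cycle x : nbhd (x : K) = [set x + 1; x - 1].
Proof.
apply/setP=> y; rewrite !inE /=; congr (_ || _).
by rewrite [x == _]eq_sym -subr_eq opprK eq_sym [LHS]eq_sym.
Qed.

Lemma deg_cycle (x : K) : deg x = 2%N.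
Proof.
rewrite /deg nbhd_cycle cards2.
have -> // : (x : 'Z_n) + 1 != x - 1.
by rewrite -subr_eq0 (_ : _ - _ = 2%:R) ?Zn_nat_eq0 //; ring.
Qed.

Lemma cycle_triangle_free : (4 <= n)%N -> triangle_free K.
Proof.
move=> n4 x y z; rewrite -!in_nbhd !nbhd_cycle !inE.
apply: no_unit_triangle.
(* Here [n >= 4] enters: it makes 3 nonzero modulo [n]. *)
by rewrite Zn_nat_eq0 //; lia.
Qed.

End Cycle.

Lemma adj_C3 (x y : cycle_graph 3) : adj x y = (x != y).
Proof. by case: x y => [[|[|[|x]]] xlt] [[|[|[|y]]] ylt]. Qed.

(** The two neighbours of [x] are distinct, hence adjacent, and an edge contained in a two-element
    set is that whole set. *)
Lemma edges_among_nbrs_C3 (x : cycle_graph 3) : edges_among_nbrs x = 1%N.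
Proof.
apply/eqP/cards1P; exists (nbhd x); apply/setP => e; rewrite inE in_set1.
have deg2 : #|nbhd x| = 2%N by apply: (@deg_cycle 3).
apply/andP/eqP => [[eE sub]|->].
  by apply/eqP; rewrite eqEcard sub (card_edge eE) deg2.
split=> //; apply/edgesP; case/eqP/cards2P: deg2 => a [b [ab ->]].
by exists a, b; rewrite adj_C3.
Qed.

(** * Attaching copies: neighbourhoods, degrees and triangles *)

Section Attach.
Variables (H : sgraph) (T : finType) (f : T -> H) (K : sgraph) (r : K).
Hypothesis f_inj : injective f.
Local Notation A := (attach f r).
Local Notation copy := (@attach_copy H T f K r).
Local Notation old := (inl : H -> A).

Lemma attach_copy_root t : copy t r = old (f t).
Proof. by rewrite /attach_copy insubF // eqxx. Qed.

Lemma attach_copy_val t (x : {x : K | x != r}) : copy t (val x) = inr (t, x).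
Proof. by rewrite /attach_copy valK. Qed.

Lemma attach_copy_eq_old t x h : copy t x = old h <-> x = r /\ h = f t.
Proof.
split=> [|[-> ->]]; last exact: attach_copy_root.
by rewrite /attach_copy; case: insubP => //; rewrite negbK => /eqP -> [].
Qed.

Lemma attach_copy_eq_new t x s y :
  copy t x = inr (s, y) <-> t = s /\ x = val y.
Proof.
split=> [|[-> ->]]; last exact: attach_copy_val.
by rewrite /attach_copy; case: insubP => // x' _ <- [-> ->].
Qed.

Lemma attach_copy_inj t : injective (copy t).
Proof.
move=> x y; have [->|yr] := eqVneq y r.
  by rewrite attach_copy_root => /attach_copy_eq_old[].
by rewrite -[y]/(val (exist (fun z => z != r) y yr))
  attach_copy_val => /attach_copy_eq_new[].
Qed.

(** A copy meets the old graph only in its root, so an edge of a copy between old vertices would be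
    a loop at the root. *)
Lemma attach_adj_old x y : adj (old x) (old y) = adj x y.
Proof.
apply/orP/idP; [case=> // | by left].
case/existsP=> t /existsP[a /existsP[b /and3P[ab]]].
move=> /eqP/esym/attach_copy_eq_old[ar _] /eqP/esym/attach_copy_eq_old[br _].
by move: ab; rewrite ar br adj_irrefl.
Qed.

Lemma attach_adj_new t (x : {x : K | x != r}) w :
  adj (inr (t, x) : A) w <-> exists2 y, w = copy t y & adj (val x) y.
Proof.
split=> [/orP[//|]|[y -> xy]].
  case/existsP=> s /existsP[a /existsP[b /and3P[ab]]].
  by move=> /eqP/esym/attach_copy_eq_new[-> <-] /eqP ->; exists b.
apply/orP; right; apply/existsP; exists t; apply/existsP; exists (val x).
by apply/existsP; exists y; rewrite xy attach_copy_val !eqxx.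
Qed.

Lemma attach_adj_copy t x y : adj (copy t x : A) (copy t y) = adj x y.
Proof.
have new a b : adj (inr (t, a) : A) (copy t b) = adj (val a) b.
  apply/idP/idP => [/attach_adj_new[c /attach_copy_inj -> //]|ab].
  by apply/attach_adj_new; exists b.
have [->|xr] := eqVneq x r; last first.
  by rewrite -[x]/(val (exist (fun z => z != r) x xr)) attach_copy_val new.
have [->|yr] := eqVneq y r.
  by rewrite attach_copy_root attach_adj_old !adj_irrefl.
rewrite -[y]/(val (exist (fun z => z != r) y yr)) attach_copy_val.
by rewrite adj_sym new adj_sym.
Qed.

Lemma nbhd_attach_new t (x : {x : K | x != r}) :
  nbhd (inr (t, x) : A) = copy t @: nbhd (val x).
Proof.
apply/setP=> w; rewrite in_nbhd; apply/idP/imsetP.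
  by case/attach_adj_new => y -> xy; exists y; rewrite ?in_nbhd.
by case=> y; rewrite in_nbhd => xy ->; apply/attach_adj_new; exists y.
Qed.

Lemma attach_adj_old_new x t (y : {x : K | x != r}) :
  adj (old x) (inr (t, y)) = (x == f t) && adj r (val y).
Proof.
rewrite adj_sym; apply/idP/andP.
  case/attach_adj_new=> z /esym/attach_copy_eq_old[-> ->].
  by rewrite adj_sym.
case=> /eqP-> ry; apply/attach_adj_new; exists r; rewrite ?attach_copy_root //.
by rewrite adj_sym.
Qed.

(** Injectivity of [f] ensures that [copy t] is the only copy glued at [f t]. *)
Lemma nbhd_attach_root t :
  nbhd (old (f t)) = (old @: nbhd (f t)) :|: (copy t @: nbhd r).
Proof.
apply/setP=> w; rewrite in_nbhd in_setU; case: w => [h|[s y]].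
  rewrite -[adj _ _]/(adj (old _) (old _)) attach_adj_old.
  rewrite (mem_imset _ _ (@inl_inj _ _)) in_nbhd.
  case: imsetP => [[z]|]; rewrite ?orbF // in_nbhd => rz.
  by move=> /esym/attach_copy_eq_old[zr _]; move: rz; rewrite zr adj_irrefl.
rewrite attach_adj_old_new; case: imsetP => [[]//|_] /=.
apply/andP/imsetP => [[/eqP/f_inj -> ry]|[z]].
  by exists (val y); rewrite ?in_nbhd ?attach_copy_val.
by rewrite in_nbhd => rz /esym/attach_copy_eq_new[-> <-].
Qed.

Lemma nbhd_attach_old x :
  (forall t, x != f t) -> nbhd (old x) = old @: nbhd x.
Proof.
move=> xf; apply/setP=> -[h|[s y]]; rewrite in_nbhd.
  by rewrite (mem_imset _ _ (@inl_inj _ _)) in_nbhd -attach_adj_old.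
by rewrite attach_adj_old_new (negbTE (xf s)); case: imsetP => // -[].
Qed.

Lemma deg_attach_new t (x : {x : K | x != r}) :
  deg (inr (t, x) : A) = deg (val x).
Proof. by rewrite /deg nbhd_attach_new card_imset //; apply: attach_copy_inj. Qed.

Lemma deg_attach_root t : deg (old (f t)) = (deg (f t) + deg r)%N.
Proof.
rewrite /deg nbhd_attach_root cardsU !card_imset; last 2 first.
- exact: attach_copy_inj.
- exact: inl_inj.
(* The degrees add up because the union is disjoint: a common element would be the root of the copy,
   a neighbour of itself. *)
rewrite (_ : _ :&: _ = set0) ?cards0 ?subn0 //.
apply/setP=> w; rewrite !inE; apply/negP => /andP[/imsetP[h _ ->] /imsetP[z]].
by rewrite in_nbhd => rz /esym/attach_copy_eq_old[zr _];
  rewrite zr adj_irrefl in rz.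
Qed.

Lemma deg_attach_old x : (forall t, x != f t) -> deg (old x) = deg x.
Proof. by move=> xf; rewrite /deg nbhd_attach_old // card_imset //; apply: inl_inj. Qed.

Hypothesis tfH : triangle_free H.

(** A triangle through a vertex of a copy stays in that copy. A new vertex has all its neighbours
    there. At the root, two old neighbours are excluded by [tfH], and an old neighbour adjacent to a
    new vertex of the copy would be the root itself. *)
Lemma attach_triangle t x a b :
    adj (copy t x : A) a -> adj (copy t x : A) b -> adj (a : A) b ->
  a \in codom (copy t).
Proof.
have [->|xr] := eqVneq x r; last first.
  rewrite -[x]/(val (exist (fun z => z != r) x xr)) attach_copy_val.
  by case/attach_adj_new=> y -> _ _ _; apply: codom_f.
rewrite attach_copy_root; case: a => [h|[s y]].
  rewrite -/(old h) attach_adj_old => xh; case: b => [h'|[s' y']].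
    by rewrite -/(old h') !attach_adj_old => /(tfH xh)/negbTE ->.
  rewrite !attach_adj_old_new => /andP[/eqP/f_inj <- _] /andP[/eqP hE _].
  by rewrite hE adj_irrefl in xh.
rewrite attach_adj_old_new => /andP[/eqP/f_inj <- _] _ _.
by rewrite -attach_copy_val codom_f.
Qed.

(** Taking images under [copy t] is a bijection between the two sets of edges, even at the root,
    whose further neighbours lie in [H]: by [attach_triangle], both ends of an edge among the
    neighbours lie in the copy. *)
Lemma edges_among_nbrs_attach_copy t x :
  edges_among_nbrs (copy t x : A) = edges_among_nbrs x.
Proof.
rewrite -[RHS](card_imset _ (imset_inj (@attach_copy_inj t))).
apply: eq_card => e; rewrite inE; apply/andP/imsetP.
  case=> /edgesP[a [b [ab ->]]]; rewrite subUset !sub1set !in_nbhd => /andP[xa xb].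
  have ba : adj b a by rewrite adj_sym.
  case/codomP: (attach_triangle xa xb ab) => a' aE.
  case/codomP: (attach_triangle xb xa ba) => b' bE; subst a b.
  rewrite !attach_adj_copy in xa xb ab.
  exists [set a'; b']; last by rewrite imsetU1 imset_set1.
  rewrite inE subUset !sub1set !in_nbhd xa xb !andbT.
  by apply/edgesP; exists a', b'.
case=> e'; rewrite inE => /andP[/edgesP[a [b [ab ->]]]].
rewrite subUset !sub1set !in_nbhd => /andP[xa xb] ->.
rewrite imsetU1 imset_set1 subUset !sub1set !in_nbhd !attach_adj_copy xa xb.
by split=> //; apply/edgesP; exists (copy t a), (copy t b); rewrite attach_adj_copy.
Qed.

Lemma edges_among_nbrs_attach_old x :
  (forall t, x != f t) -> edges_among_nbrs (old x) = 0%N.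
Proof.
move=> xf; apply: edges_among_nbrs_eq0 => a b.
rewrite -!in_nbhd nbhd_attach_old //.
move=> /imsetP[a' xa ->] /imsetP[b' xb ->]; rewrite in_nbhd attach_adj_old.
by rewrite !in_nbhd in xa xb; apply: tfH xb.
Qed.

End Attach.

(** * The edge-path transformation: absence of triangles, and degrees *)

Section EdgePathTheory.
Variables (m : nat) (G : sgraph).
Hypothesis m_ge2 : (2 <= m)%N.
Local Notation P := (edge_path m G).
Local Notation old := (inl : G -> P).
Implicit Types (e : oedge G) (x y : G).

Lemma ep_path_new e (j : 'I_m.-1) : ep_path m e j.+1 = inr (e, j).
Proof. by rewrite /ep_path valK. Qed.

Lemma ep_path_eq_new e k e' (j : 'I_m.-1) :
  ep_path m e k = inr (e', j) <-> e = e' /\ k = j.+1.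
Proof.
split=> [|[-> ->]]; last exact: ep_path_new.
by case: k => //= k; case: insubP => // j' _ <- [-> ->].
Qed.

(** The bound on [k] matters: [ep_path] takes the value [(val e).2] at every index from [m] on. *)
Lemma ep_path_eq_old e k x : (k <= m)%N ->
  ep_path m e k = old x <->
  (k = 0%N /\ x = (val e).1) \/ (k = m /\ x = (val e).2).
Proof.
move=> km; case: k km => [_|k km] /=.
  by split=> [[->]|[[_ ->]//|[m0 _]]]; [left | move: m_ge2; rewrite -m0].
case: insubP => [j kj _|kj]; split=> //.
- by case=> -[] //; lia.
- by case=> <-; right; split=> //; lia.
- by case=> -[] // _ ->.
Qed.

Lemma oedge_adj e : adj (val e).1 (val e).2.
Proof. by case/andP: (valP e). Qed.

Lemma oedge_neq e : (val e).1 != (val e).2.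
Proof. by apply: contraTneq (oedge_adj e) => ->; rewrite adj_irrefl. Qed.

Lemma edge_path_adjP (u w : P) :
  reflect (exists e k, (k < m)%N /\
     ((u = ep_path m e k /\ w = ep_path m e k.+1) \/
      (w = ep_path m e k /\ u = ep_path m e k.+1))) (adj u w).
Proof.
apply: (iffP existsP) => [[e /existsP[k]]|[e [k [km h]]]].
  by case/orP=> /andP[/eqP uE /eqP wE]; exists e, k;
    (split; [exact: ltn_ord | auto]).
exists e; apply/existsP; exists (Ordinal km); apply/orP => /=.
by case: h => -[-> ->]; rewrite !eqxx; auto.
Qed.

Lemma nbhd_edge_path_new e (j : 'I_m.-1) :
  nbhd (inr (e, j) : P) = [set ep_path m e j; ep_path m e j.+2].
Proof.
have jm := ltn_ord j.
apply/setP=> w; rewrite in_nbhd in_set2; apply/edge_path_adjP/orP.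
  case=> e' [k [km [] []]].
    by move=> /esym/ep_path_eq_new[-> ->] ->; right.
  by move=> -> /esym/ep_path_eq_new[-> [->]]; left.
case=> /eqP->; [exists e, (nat_of_ord j) | exists e, j.+1]; split; try lia.
  by right; rewrite ep_path_new.
by left; rewrite ep_path_new.
Qed.

Lemma edge_path_adj_new e (j : 'I_m.-1) e' (k : 'I_m.-1) :
  adj (inr (e, j) : P) (inr (e', k)) = (e == e') && ((j.+1 == k) || (k.+1 == j)).
Proof.
rewrite -in_nbhd nbhd_edge_path_new in_set2 ![inr (e', k) == _]eq_sym.
apply/orP/andP => [[]/eqP/ep_path_eq_new[-> kE]|[/eqP <- /orP[]/eqP kE]].
- by rewrite kE !eqxx orbT.
- by case: kE => ->; rewrite !eqxx.
- by right; apply/eqP/ep_path_eq_new; rewrite kE.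
- by left; apply/eqP/ep_path_eq_new; rewrite kE.
Qed.

(** Index [j] stands for position [j + 1] on the path, so the inner vertices next to the two ends
    are those with [j = 0] and [j + 2 = m]. *)
Lemma edge_path_adj_old_new x e (j : 'I_m.-1) :
  adj (old x) (inr (e, j)) =
  ((x == (val e).1) && (j == 0%N :> nat)) ||
  ((x == (val e).2) && (j.+2 == m)).
Proof.
have jm := ltn_ord j.
rewrite adj_sym -in_nbhd nbhd_edge_path_new in_set2 ![inl x == _]eq_sym.
apply/orP/orP => -[].
- by move/eqP/ep_path_eq_old=> []; [lia|case=> -> ->; rewrite !eqxx; left|lia].
- by move/eqP/ep_path_eq_old=> []; [lia|lia|case=> -> ->; rewrite !eqxx; right].
- by case/andP=> /eqP-> /eqP j0; left; apply/eqP/ep_path_eq_old; [lia|auto].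
- by case/andP=> /eqP-> /eqP j0; right; apply/eqP/ep_path_eq_old; [lia|auto].
Qed.

(** Old vertices occupy positions 0 and [m], which are not consecutive as [m >= 2]. *)
Lemma edge_path_adj_old x y : adj (old x) (old y) = false.
Proof.
have end_eq e k z : (k <= m)%N -> old z = ep_path m e k -> k = 0%N \/ k = m.
  by move=> km /esym/(ep_path_eq_old e z km)[[]|[]]; auto.
apply/edge_path_adjP => -[e [k [km h]]].
have [k0 k1] : (k = 0 \/ k = m)%N /\ (k.+1 = 0 \/ k.+1 = m)%N.
  by case: h => -[hu hw]; split; apply: end_eq hu || apply: end_eq hw; lia.
by move: m_ge2; lia.
Qed.

(** In a triangle with an old vertex, the other two would be inner vertices of one path, both next
    to the same end, hence equal. Three inner vertices would have pairwise consecutive positions on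
    one path, against parity. *)
Lemma edge_path_triangle_free : triangle_free P.
Proof.
have tf_old x b c : adj (old x) b -> adj (old x) c -> ~~ adj (b : P) c.
  case: b c => [b|[e j]] [c|[e' k]]; rewrite ?edge_path_adj_old //.
  rewrite !edge_path_adj_old_new edge_path_adj_new => h1 h2.
  apply/negP => /andP[/eqP ee jk]; subst e'; have := oedge_neq e.
  by case/orP: h1 => /andP[/eqP<- h1]; case/orP: h2 => /andP[h2 h3];
    rewrite ?(eqP h2) ?eqxx //; move: jk h1 h3; lia.
move=> a b c; case: a => [x|[e j]]; first exact: tf_old.
case: b => [x|[e' k]] ab ac; apply/negP => bc.
  by rewrite adj_sym in ab; move: (tf_old x _ _ ab bc); rewrite ac.
case: c ac bc => [x|[e'' l]] ac bc.
  rewrite adj_sym in ac; rewrite adj_sym in bc.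
  by move: (tf_old x _ _ ac bc); rewrite ab.
by move: ab ac bc; rewrite !edge_path_adj_new; lia.
Qed.

(** The vertices before and after are distinct; if both are old, they are the two ends of [e], which
    differ since there are no loops. *)
Lemma deg_edge_path_new e (j : 'I_m.-1) : deg (inr (e, j) : P) = 2%N.
Proof.
have jm := ltn_ord j.
rewrite /deg nbhd_edge_path_new cards2; case: eqP => //.
case jE: (ep_path m e j) => [x|[e' k]] /esym.
  move: jE => /ep_path_eq_old h /ep_path_eq_old h'.
  by have := oedge_neq e;
    case: h h' => [|[_ ->]|[]] //; try lia; move=> [|[]|[_ ->]]; rewrite ?eqxx; lia.
by move: jE => /ep_path_eq_new[_ h] /ep_path_eq_new[_ h']; lia.
Qed.

(** Sending the inner vertex next to [x] on an edge to the far end of that edge is a bijection from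
    the new neighbours of [x] to the original ones. *)
Lemma deg_edge_path_old x : deg (old x) = deg x.
Proof.
(* The value [x] at old vertices is a dummy: no old vertex is a neighbour of [old x]. *)
pose other (w : P) : G :=
  if w is inr (e, _) then if (val e).1 == x then (val e).2 else (val e).1 else x.
have inj : {in nbhd (old x) &, injective other}.
  move=> [a|[e j]] [b|[e' k]]; rewrite !in_nbhd ?edge_path_adj_old //.
  rewrite !edge_path_adj_old_new /=.
  have [ne ne'] := (oedge_neq e, oedge_neq e').
  have [lt lt'] := (valP e, valP e').
  case/andP: lt => _ lt; case/andP: lt' => _ lt'.
  (* If [x] is on the same side of [e] and [e'], equal far ends give equal edges and positions. If
     it is on opposite sides, they contradict the ordering of ranks. *)
  case/orP=> /andP[/eqP xe jE] /orP[] /andP[/eqP xe' kE]; move: ne ne' lt lt'.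
  - rewrite -xe -xe' eqxx => _ _ _ _ e2; congr (inr (_, _)).
      by apply/val_inj/eqP;
        rewrite [val e]surjective_pairing [val e']surjective_pairing xpair_eqE -xe -xe' e2 !eqxx.
    by apply: ord_inj; lia.
  - by rewrite -xe -xe' eqxx => _ /negbTE -> lt lt' e2;
      rewrite e2 in lt; have := ltn_trans lt lt'; rewrite ltnn.
  - by rewrite -xe -xe' eqxx => /negbTE -> _ lt lt' e2;
      rewrite e2 in lt; have := ltn_trans lt lt'; rewrite ltnn.
  - rewrite -xe -xe' => /negbTE -> /negbTE -> _ _ e1; congr (inr (_, _)).
      by apply/val_inj/eqP;
        rewrite [val e]surjective_pairing [val e']surjective_pairing xpair_eqE -xe -xe' e1 !eqxx.
    by apply: ord_inj; lia.
rewrite /deg -(card_in_imset inj); apply: eq_card => y; rewrite in_nbhd.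
apply/imsetP/idP => [[[a|[e j]]]|xy].
- by rewrite in_nbhd edge_path_adj_old.
- rewrite in_nbhd edge_path_adj_old_new /= => h ->; have := oedge_adj e.
  case: eqP => [<- //|xe].
  by case/orP: h => /andP[/eqP xE _]; [case: xe | rewrite adj_sym xE].
have rank_neq : enum_rank x != enum_rank y :> nat.
  apply: contraTneq xy => /val_inj/enum_rank_inj ->; by rewrite adj_irrefl.
have yx : adj y x by rewrite adj_sym.
(* The end of lower rank is listed first, so the preimage of [y] is the first inner vertex of the
   path if [x] has lower rank, and the last one, of index [m - 2], otherwise. *)
have [lt|lt] : (enum_rank x < enum_rank y)%N \/ (enum_rank y < enum_rank x)%N by lia.
  have oe : adj (x, y).1 (x, y).2 && (enum_rank (x, y).1 < enum_rank (x, y).2)%N.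
    by rewrite /= xy.
  have lt0 : (0 < m.-1)%N by lia.
  exists (inr (Sub (x, y) oe, Ordinal lt0)); last by rewrite /= eqxx.
  by rewrite in_nbhd edge_path_adj_old_new /= !eqxx.
have oe : adj (y, x).1 (y, x).2 && (enum_rank (y, x).1 < enum_rank (y, x).2)%N.
  by rewrite /= yx.
have lt0 : (m.-2 < m.-1)%N by lia.
exists (inr (Sub (y, x) oe, Ordinal lt0)); last first.
  by rewrite /=; case: eqP xy => // ->; rewrite adj_irrefl.
by rewrite in_nbhd edge_path_adj_old_new /= !eqxx orbC (_ : m.-2.+2 == m) //; lia.
Qed.

End EdgePathTheory.

(** * Degrees and clustering in the self-similar graphs *)

Section SelfSimilar.
Variables m n : nat.
Hypotheses (m_ge2 : (2 <= m)%N) (n_ge3 : (3 <= n)%N).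

Section Step.
Variable i : nat.
Local Notation G := (ssgraph m n i).
Local Notation G' := (ssgraph m n i.+1).

Let root (v : G) : edge_path m G := inl v.

Let root_inj : injective root.
Proof. by move=> u v []. Qed.

Let tfP : triangle_free (edge_path m G) := edge_path_triangle_free m_ge2.

Let not_root q v : inr q != root v.
Proof. by []. Qed.

Lemma deg_ssgraph_old (v : G) : deg (inl (inl v) : G') = (deg v).+2.
Proof.
rewrite [LHS](deg_attach_root (f := root) (K := cycle_graph n) 0 root_inj v).
by rewrite deg_edge_path_old // deg_cycle // addn2.
Qed.

Lemma deg_ssgraph_path q : deg (inl (inr q) : G') = 2%N.
Proof.
rewrite [LHS](deg_attach_old (f := root) (K := cycle_graph n) 0 (not_root q)).
by case: q => e j; rewrite deg_edge_path_new.
Qed.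

Lemma deg_ssgraph_copy q : deg (inr q : G') = 2%N.
Proof.
case: q => v x.
by rewrite [LHS](deg_attach_new root v x) deg_cycle.
Qed.

Lemma edges_among_nbrs_ssgraph_old (v : G) :
  edges_among_nbrs (inl (inl v) : G') = edges_among_nbrs (0 : cycle_graph n).
Proof.
rewrite -(edges_among_nbrs_attach_copy (f := root)
  (K := cycle_graph n) 0 root_inj tfP v).
by rewrite attach_copy_root.
Qed.

Lemma edges_among_nbrs_ssgraph_path q :
  edges_among_nbrs (inl (inr q) : G') = 0%N.
Proof.
exact: (edges_among_nbrs_attach_old (f := root)
  (K := cycle_graph n) 0 tfP (not_root q)).
Qed.

Lemma edges_among_nbrs_ssgraph_copy v x :
  edges_among_nbrs (inr (v, x) : G') = edges_among_nbrs (val x : cycle_graph n).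
Proof.
rewrite -(edges_among_nbrs_attach_copy (f := root)
  (K := cycle_graph n) 0 root_inj tfP v).
by rewrite attach_copy_val.
Qed.

(** The arbitrary [F] acts as a test function that records the whole degree distribution: old
    degrees grow by 2, and all other vertices have degree 2. *)
Lemma sum_deg_ssgraphS (F : nat -> rat) :
  \sum_(v : G') F (deg v) =
  \sum_(v : G) F (deg v).+2 + (#|G'|%:R - #|G|%:R) * F 2%N.
Proof.
have cardE (g : G' -> rat) : \sum_(v : G') g v =
    \sum_(v : G) g (inl (inl v)) + \sum_q g (inl (inr q)) + \sum_q g (inr q).
  by rewrite [LHS]big_sumType /=; congr (_ + _); rewrite [LHS]big_sumType.
(* Cardinals become sums of ones, so that [cardE] splits them along the same three kinds of
   vertices. *)
rewrite -[#|G'|]sum1_card -[#|G|]sum1_card !natr_sum !cardE /=.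
under eq_bigr do rewrite deg_ssgraph_old.
under [X in _ + X + _]eq_bigr do rewrite deg_ssgraph_path -[F _]mul1r.
under [X in _ + X = _]eq_bigr do rewrite deg_ssgraph_copy -[F _]mul1r.
rewrite -!mulr_suml; ring.
Qed.

End Step.

(** The first term accounts for the initial cycle, the term of index [j] for the vertices born in
    [G^(j)], which have gained 2 at each of the [i - j] later steps. *)
Lemma sum_deg_ssgraph i (F : nat -> rat) :
  \sum_(v : ssgraph m n i) F (deg v) =
  n%:R * F (2 * (i + 1))%N
  + \sum_(1 <= j < i.+1)
      ((Vcard m n (j + 1))%:R - (Vcard m n j)%:R) * F (2 * (i - j + 1))%N.
Proof.
elim: i F => [|i IH] F.
  rewrite big_geq // addr0; under eq_bigr do rewrite deg_cycle //.
  by rewrite sumr_const card_ord mulr_natl Zp_cast // ltnW.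
(* The hypothesis is used for the shifted function, and the newborn vertices supply the last
   summand. *)
rewrite sum_deg_ssgraphS (IH (fun d => F d.+2)) [in RHS]big_nat_recr //= addrA.
congr (_ + _ + _).
- by congr (_ * F _); lia.
- by apply: eq_big_nat => j /andP[_ ji]; congr (_ * F _); lia.
- by rewrite addn1 subnn.
Qed.

Lemma avg_clustering_ssgraph_eq0 i :
  (4 <= n)%N -> avg_clustering (ssgraph m n i) = 0.
Proof.
move=> n4; suff e0 (v : ssgraph m n i) : edges_among_nbrs v = 0%N.
  by rewrite /avg_clustering big1 ?mul0r // => v _; rewrite clusteringE e0 mul0r.
have C0 (x : cycle_graph n) : edges_among_nbrs x = 0%N.
  by apply: edges_among_nbrs_eq0 => y z; apply: cycle_triangle_free.
case: i v => [|i] //= [[v|q]|[v x]].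
- by rewrite edges_among_nbrs_ssgraph_old.
- exact: edges_among_nbrs_ssgraph_path.
- by rewrite edges_among_nbrs_ssgraph_copy.
Qed.

End SelfSimilar.

(** A vertex of [G^(i)] now lies in exactly one triangle, whence a reciprocal binomial. Inner path
    vertices contribute 0. Each copy brings two new vertices, of degree 2 and coefficient 1. *)
Lemma sum_clustering_ssgraph3 m i : (2 <= m)%N ->
  \sum_(v : ssgraph m 3 i.+1) clustering v =
  \sum_(v : ssgraph m 3 i) 'C((deg v).+2, 2)%:R^-1 + 2 * #|ssgraph m 3 i|%:R.
Proof.
move=> m2; rewrite [LHS]big_sumType /=; congr (_ + _).
  rewrite [LHS]big_sumType /= [X in _ + X]big1 ?addr0 => [|q _].
    apply: eq_bigr => v _; rewrite clusteringE edges_among_nbrs_ssgraph_old //.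
    by rewrite edges_among_nbrs_C3 deg_ssgraph_old // div1r.
  by rewrite clusteringE edges_among_nbrs_ssgraph_path // mul0r.
transitivity (\sum_(q : ssgraph m 3 i * {x : cycle_graph 3 | x != 0}) (1 : rat)).
  apply: eq_bigr => -[v x] _; rewrite clusteringE edges_among_nbrs_ssgraph_copy //.
  by rewrite edges_among_nbrs_C3 deg_ssgraph_copy.
by rewrite sumr_const card_prod card_sig cardC1 card_ord mulrnA mulr_natl.
Qed.

Theorem theorem2 (n m : nat) (hn : (3 <= n)%N) (hm : (2 <= m)%N) :
  ((4 <= n)%N -> forall i : nat, avg_clustering (ssgraph m n i) = 0) /\
  (n = 3%N -> forall i : nat, (1 <= i)%N ->
     avg_clustering (ssgraph m 3 i) =
     (3 / 'C(2 * (i + 1), 2)%:R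
      + \sum_(1 <= j < i)
          ((Vcard m 3 (j + 1))%:R - (Vcard m 3 j)%:R)
            / 'C(2 * (i - j + 1), 2)%:R
      + 2 * (Vcard m 3 i)%:R)
     / (Vcard m 3 (i + 1))%:R).
Proof.
split=> [n4 i|_ [//|i] _]; first exact: avg_clustering_ssgraph_eq0.
rewrite /avg_clustering sum_clustering_ssgraph3 //.
(* The degrees are those of the previous graph, hence the shift by 2; the size of the initial cycle
   supplies the numerator 3. *)
rewrite (sum_deg_ssgraph hm _ _ (fun d => 'C(d.+2, 2)%:R^-1)) // [in RHS]addn1.
congr ((_ + _ + _) / _).
- by congr (_ / ('C(_, _))%:R); lia.
- by apply: eq_big_nat => j /andP[_ ji]; congr (_ / ('C(_, _))%:R); lia.
Qed.
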